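(* Let $(\Omega,\mathcal F,\mathbb P)$ be a probability space. For each $N\in\mathbb N$ let $\{t_j\}_{j\in\mathbb N}=\{t_j^{(N)}\}_{j\in\mathbb N}$ be a sequence of positive random variables on this space (the dependence on $N$ is suppressed in the notation) satisfying: (i) $\mathbb E(t_i)=\frac1N$ for all $i$ and all $N$; (ii) there exist $r>0$ and a constant $\tilde C>0$ such that $\mathbb E(t_i^{2+r})\le \frac{\tilde C}{N^{2+r}}$ for all $i$ and all $N$; (iii) for all $m\in\mathbb N$ (and all $N$), the vector $(t_1,\dots,t_m)$ is negatively superadditive dependent. Set $\tau_0=0$ and $\tau_i=\sum_{j=1}^i t_j$ for $i\ge1$. Let $W=(W_s)_{s\ge0}$ be a random function on the same probability space that is almost surely continuous, let $a\in\mathbb R$, and consider observations $$Y_{\tau_i}=a\tau_i+W_{\tau_i}-W_{\tau_{i-1}},\qquad i=1,\dots,N,$$ with estimator $$\hat a_{N}=\frac{\sum_{i=1}^{N}Y_{\tau_i}\tau_i}{\sum_{i=1}^{N}\tau_i^2}.$$ Then, almost surely as $N\to\infty$, $$N\big(\hat a_{N}-a\big)\to 3\int_0^1 (W_1-W_s)\,ds.$$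
   Context: A function $\phi:\mathbb R^m\to\mathbb R$ is superadditive if $\phi(x\vee y)+\phi(x\wedge y)\ge\phi(x)+\phi(y)$ for all $x,y\in\mathbb R^m$, where $\vee$ and $\wedge$ denote componentwise maximum and minimum. A random vector $(X_1,\dots,X_m)$ is negatively superadditive dependent (NSD) if for every superadditive $\phi$ such that the expectation $\mathbb E\phi(X_1,\dots,X_m)$ exists, $\mathbb E\phi(X_1,\dots,X_m)\le\mathbb E\phi(X_1^*,\dots,X_m^* )$, where $X_1^*,\dots,X_m^*$ are independent and $X_i^*$ has the same distribution as $X_i$ for each $i$. *)

(* Defs.v *)
From HB Require Import structures.
From mathcomp Require Import all_boot all_order all_algebra.
From mathcomp Require Import all_classical all_reals all_analysis.
Set Implicit Arguments. Unset Strict Implicit. Unset Printing Implicit Defensive.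
Import Order.TTheory GRing.Theory Num.Theory.
Import numFieldNormedType.Exports.
Local Open Scope classical_set_scope.
Local Open Scope ring_scope.

(* Componentwise maximum / minimum on R^m, represented as m.-tuple R
   (which carries the product sigma-algebra of MathComp-Analysis). *)
Definition tjoin (R : realType) m (x y : m.-tuple R) : m.-tuple R :=
  [tuple Num.max (tnth x i) (tnth y i) | i < m].
Definition tmeet (R : realType) m (x y : m.-tuple R) : m.-tuple R :=
  [tuple Num.min (tnth x i) (tnth y i) | i < m].

Definition superadditive (R : realType) m (phi : m.-tuple R -> R) : Prop :=
  forall x y : m.-tuple R, phi x + phi y <= phi (tjoin x y) + phi (tmeet x y).

Definition expectation_exists d (T : measurableType d) (R : realType)
  (P : probability T R) (f : T -> R) : Prop :=
  measurable_fun setT f /\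
  ((\int[P]_w (Num.max (f w) 0)%:E < +oo)%E \/
   (\int[P]_w (Num.max (- f w) 0)%:E < +oo)%E).

Definition mutually_independent d (T : measurableType d) (R : realType)
  (P : probability T R) m (X : 'I_m -> T -> R) : Prop :=
  forall B : 'I_m -> set R, (forall i, measurable (B i)) ->
    P (\bigcap_(i in [set: 'I_m]) (X i @^-1` B i)) =
    (\prod_(i < m) P (X i @^-1` B i))%E.

Definition same_law d (T : measurableType d) d' (T' : measurableType d')
  (R : realType) (P : probability T R) (X : T -> R)
  (P' : probability T' R) (X' : T' -> R) : Prop :=
  forall B : set R, measurable B -> P (X @^-1` B) = P' (X' @^-1` B).

(* Negative superadditive dependence: for every superadditive (Borel) phi
   whose expectations exist, E phi(X) <= E phi(X^* ), where X^* is any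
   vector of independent random variables with the same marginals as X
   (the value E phi(X^* ) only depends on these marginals). *)
Definition NSD d (T : measurableType d) (R : realType) (P : probability T R)
  m (X : 'I_m -> T -> R) : Prop :=
  forall d' (T' : measurableType d') (P' : probability T' R)
         (Xs : 'I_m -> T' -> R),
    (forall i, measurable_fun setT (Xs i)) ->
    mutually_independent P' Xs ->
    (forall i, same_law P (X i) P' (Xs i)) ->
    forall phi : m.-tuple R -> R,
      measurable_fun setT phi -> superadditive phi ->
      expectation_exists P (fun w => phi [tuple X i w | i < m]) ->
      expectation_exists P' (fun w => phi [tuple Xs i w | i < m]) ->
      ('E_P[fun w => phi [tuple X i w | i < m]]
         <= 'E_P'[fun w => phi [tuple Xs i w | i < m]])%E.

(* t j stands for t_{j+1}; tau i = t_1 + ... + t_i, tau 0 = 0 *)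
Definition tau (T : Type) (R : realType) (t : nat -> T -> R) (i : nat) (w : T) : R :=
  \sum_(j < i) t j w.

Definition Yobs (T : Type) (R : realType) (a : R) (W : R -> T -> R)
  (t : nat -> T -> R) (i : nat) (w : T) : R :=
  a * tau t i w + W (tau t i w) w - W (tau t i.-1 w) w.

Definition ahat (T : Type) (R : realType) (a : R) (W : R -> T -> R)
  (t : nat -> T -> R) (N : nat) (w : T) : R :=
  (\sum_(1 <= i < N.+1) Yobs a W t i w * tau t i w) /
  (\sum_(1 <= i < N.+1) tau t i w ^+ 2).

(* Main.v *)
(**
  By Abel summation, N (hat a_N - a) is the quotient of
  W_(tau_N) tau_N - sum_i W_(tau_(i-1)) t_i by (1/N) sum_i tau_i^2, so on a
  path where W is continuous the limit follows from Riemann sums as soon as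
  max_(i <= N) |tau_i - i/N| tends to 0.

  This uniform closeness holds almost surely by Borel-Cantelli. For a monotone
  h the map x |-> exp (sum_i h x_i) is superadditive, so negative superadditive
  dependence bounds E exp (sum_i h t_i) by the product of the E exp (h t_i).
  Chernoff's inequality with h x = - lam x controls the lower deviations of
  tau_i, and with h x = lam min(x, 1/(2 lam)) the upper ones, up to the event
  that some t_j reaches 1/(2 lam), which the moment of order 2 + r controls.
  With lam = N^(r / (2 (2 + r))), all these probabilities together are
  O(N^(-1 - r/2)).
*)
Require Import Defs.
From HB Require Import structures.
From mathcomp Require Import all_boot all_order all_algebra.
From mathcomp Require Import all_classical all_reals all_analysis.
From mathcomp Require Import measurable_realfun.
From mathcomp Require Import ring lra.
Import Order.TTheory GRing.Theory Num.Theory.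
Import numFieldNormedType.Exports.
Local Open Scope classical_set_scope.
Local Open Scope ring_scope.
Set Implicit Arguments.
Unset Strict Implicit.

(** * Independent copies and exponential moments under negative superadditive dependence *)

(* Applied to indicator functions, the product formula yields both the
   independence of the copies and the equality of the marginal laws. *)
Lemma independent_copies d (T : measurableType d) (R : realType)
    (P : probability T R) (X : nat -> T -> R) :
  (forall i, measurable_fun setT (X i)) -> forall m : nat,
  exists (d' : measure_display) (T' : measurableType d')
    (P' : probability T' R) (Xs : nat -> T' -> R),
    (forall i, measurable_fun setT (Xs i)) /\
    forall g : nat -> R -> R, (forall i, measurable_fun setT (g i)) ->
      (forall i x, 0 <= g i x) ->
      (\int[P']_w (\prod_(i < m) g i (Xs i w))%:E =
       \prod_(i < m) \int[P]_w (g i (X i w))%:E)%E.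
Proof.
move=> mX; elim=> [|m [d' [T' [P' [Xs [mXs IH]]]]]].
  exists d, T, P, X; split => // g mg g0.
  under eq_integral do rewrite big_ord0.
  by rewrite big_ord0 integral_cst//= mul1e; exact: probability_setT.
exists _, (T' * T)%type, (P' \x P)%E.
(* The new factor space carries coordinate [m]. Coordinates beyond [m] do not enter the product and
   only have to stay measurable. *)
exists (fun i z => if i == m then X m z.2 else Xs i z.1); split.
  move=> i; case: eqP => _; exact: measurableT_comp.
move=> g mg g0.
pose F w := \prod_(i < m) g i (Xs i w).
have F0 w : 0 <= F w by apply: prodr_ge0.
have mF : measurable_fun setT F.
  by apply: measurable_prod => i _; exact: measurableT_comp.
have mgX : measurable_fun setT (fun w => g m (X m w)) by exact: measurableT_comp.
transitivity (\int[(P' \x P)%E]_z (F z.1 * g m (X m z.2))%:E)%E.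
  apply: eq_integral => z _; rewrite big_ord_recr /= eqxx; congr (_ * _)%:E.
  by apply: eq_bigr => i _; rewrite ltn_eqF.
rewrite fubini_tonelli1 => [||z]; last 2 first.
- apply/measurable_EFinP; apply: measurable_funM.
    exact: (measurableT_comp mF measurable_fst).
  exact: (measurableT_comp mgX measurable_snd).
- by rewrite lee_fin mulr_ge0.
have G0 : (0 <= \int[P]_w (g m (X m w))%:E)%E.
  by apply: integral_ge0 => w _; rewrite lee_fin.
rewrite big_ord_recr/= -(IH g mg g0) -ge0_integralZr//; last 2 first.
- exact/measurable_EFinP.
- by move=> w _; rewrite lee_fin; exact: F0.
apply: eq_integral => x _; rewrite /fubini_F /=; under eq_integral do rewrite EFinM.
rewrite ge0_integralZl_EFin//; first by move=> w _; rewrite lee_fin.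
exact/measurable_EFinP.
Qed.

(** In each coordinate, join and meet merely permute the two values, so the exponents at join and
    meet have the same sum as those at [x] and [y]. Monotonicity places the exponent at the join on
    one side of both, and convexity of exp then favours the spread-out pair. *)
Lemma superadditive_expR_sum (R : realType) (m : nat) (h : R -> R) :
  {homo h : x y / x <= y} \/ {homo h : x y /~ x <= y} ->
  superadditive (fun x : m.-tuple R => expR (\sum_(i < m) h (tnth x i))).
Proof.
move=> hh x y.
set a := \sum_(i < m) h (tnth x i).
set b := \sum_(i < m) h (tnth y i).
set j := \sum_(i < m) h (tnth (tjoin x y) i).
set k := \sum_(i < m) h (tnth (tmeet x y) i).
have E : j + k = a + b.
  rewrite -!big_split/=; apply: eq_bigr => i _.
  by rewrite !tnth_mktuple; case: leP => // _; rewrite addrC.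
(* Since j + k = a + b, this product is e^j (e^j + e^k - e^a - e^b). *)
have S : 0 <= (expR j - expR a) * (expR j - expR b).
  case: hh => hh.
    apply: mulr_ge0; rewrite subr_ge0 ler_expR; apply: ler_sum => i _;
      by apply: hh; rewrite tnth_mktuple le_max lexx ?orbT.
  apply: mulr_le0; rewrite subr_le0 ler_expR; apply: ler_sum => i _;
    by apply: hh; rewrite tnth_mktuple le_max lexx ?orbT.
have {E} : expR j * expR k = expR a * expR b by rewrite -!expRD E.
have := expR_gt0 j; nra.
Qed.

Lemma NSD_expR_sum d (T : measurableType d) (R : realType)
    (P : probability T R) (X : nat -> T -> R) (m : nat) (h : R -> R) :
  (forall i, measurable_fun setT (X i)) ->
  NSD P (fun i : 'I_m => X i) ->
  measurable_fun setT h ->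
  {homo h : x y / x <= y} \/ {homo h : x y /~ x <= y} ->
  (\int[P]_w (expR (\sum_(i < m) h (X i w)))%:E <=
   \prod_(i < m) \int[P]_w (expR (h (X i w)))%:E)%E.
Proof.
move=> mX nsd mh hh.
have [d' [T' [P' [Xs [mXs prodE]]]]] := independent_copies P mX m.
pose phi := (fun x : m.-tuple R => expR (\sum_(i < m) h (tnth x i))).
have mphi : measurable_fun setT phi.
  apply: measurableT_comp => //; apply: measurable_sum => i.
  by apply: measurableT_comp => //; exact: measurable_tnth.
have mXB d1 (T1 : measurableType d1) (Q : probability T1 R) (Y : T1 -> R) (B : set R) :
    measurable_fun setT Y -> measurable B ->
    (\int[Q]_w (\1_B (Y w))%:E = Q (Y @^-1` B))%E.
  move=> mY mB; rewrite (_ : (fun w => _) = EFin \o \1_(Y @^-1` B)).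
    rewrite integral_indic ?setIT//.
    by rewrite -[X in measurable X]setTI; exact: mY.
  by apply/funext => w; rewrite /= !indicE; congr (_%:R%:E); rewrite !in_setE.
have same i : (i < m)%N -> same_law P (X i) P' (Xs i).
  move=> im B mB.
  (* An indicator at index [i] and 1 at all other indices isolate the marginal law of [Xs i]. *)
  have /= := prodE (fun j => if j == i then \1_B else cst 1) _ _.
  rewrite (bigD1 (Ordinal im))//= eqxx big1 ?mule1; last first.
    move=> j ji; rewrite ifF; last by apply/negbTE; exact: ji.
    transitivity (\int[P]_w (cst 1%:E w))%E; first exact: eq_integral.
    by rewrite integral_cst//= mul1e; exact: probability_setT.
  under eq_integral.
    move=> w _; rewrite (bigD1 (Ordinal im))//= eqxx big1 ?mulr1; last first.
      by move=> j ji; rewrite ifF//; apply/negbTE; exact: ji.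
    over.
  rewrite !mXB// => -> // j.
    by case: eqP => // _; exact: measurable_indic.
  by move=> x; case: eqP => // _; rewrite indicE.
have indep : mutually_independent P' (fun i : 'I_m => Xs i).
  move=> B mB.
  (* [prodE] takes functions indexed by all naturals, while [B] lives on ['I_m]; the default [cst 1]
     fills the indices outside. *)
  have := prodE (fun j => if insub j is Some i then \1_(B i) else cst 1) _ _.
  under eq_bigr => i _ do rewrite valK mXB//.
  under [in X in _ -> _ = X]eq_bigr => i _ do rewrite -(same i (ltn_ord i) (B i) (mB i)).
  move=> <-; last 2 first.
  - by move=> j; case: insubP => // i _ _; exact: measurable_indic.
  - by move=> j x; case: insubP => // i _ _; rewrite indicE.
  rewrite -[X in P' X]setIT -integral_indic//; last first.
    apply: fin_bigcap_measurable => // i _.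
    by rewrite -[X in measurable X]setTI; exact: mXs.
  apply: eq_integral => w _; congr (_%:E).
  under [RHS]eq_bigr => i _ do rewrite valK indicE.
  rewrite indicE; case: (boolP (w \in _)) => [|/negP]; rewrite inE => wB.
    by rewrite big1// => i _; rewrite mem_set//; exact: wB.
  have [i] : exists i, ~ B i (Xs i w).
    by apply/existsNP => XB; apply: wB => i _; exact: XB.
  by move=> nB; rewrite (bigD1 i)//= memNset// mul0r.
(* As [phi] is positive, its negative part integrates to 0, so the expectation exists even when it
   is infinite. *)
have exE d1 (T1 : measurableType d1) (Q : probability T1 R) (Y : nat -> T1 -> R) :
    (forall i, measurable_fun setT (Y i)) ->
    expectation_exists Q (fun w => phi [tuple Y i w | i < m]).
  move=> mY; split.
    apply: measurableT_comp => //; apply/measurable_fun_tnthP => i.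
    by rewrite [X in measurable_fun _ X](_ : _ = Y i)//; apply/funext => w;
      rewrite /= tnth_mktuple.
  right; rewrite integral0_eq// => w _; congr (_%:E).
  by apply/max_idPr; rewrite oppr_le0 expR_ge0.
have := nsd d' T' P' (fun i => Xs i) (fun i => mXs i) indep
  (fun i => same i (ltn_ord i)) phi mphi (@superadditive_expR_sum R m h hh)
  (exE _ _ _ _ mX) (exE _ _ _ _ mXs).
rewrite unlock.
under eq_integral do (rewrite /phi; under eq_bigr do rewrite tnth_mktuple).
move=> /le_trans; apply.
under eq_integral do
  (rewrite /phi; under eq_bigr do rewrite tnth_mktuple; rewrite expR_sum).
rewrite (prodE (fun _ x => expR (h x)))// => _.
exact: measurableT_comp.
Qed.

(** * Elementary estimates for exponentials and power series *)

Lemma expR_le_quadratic (R : realType) (u : R) :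
  u <= 2^-1 -> expR u <= 1 + u + 2 * u ^+ 2.
Proof.
move=> u2; have e0 := expR_gt0 u.
(* exp u <= 1 / (1 - u) <= 1 + u + 2 u^2, the latter since u <= 1/2. *)
have : expR u * expR (- u) = 1 by rewrite -expRD subrr expR0.
have := expR_ge1Dx (- u) => e1 e2.
have {e1 e2} : expR u * (1 - u) <= 1 by rewrite -[leRHS]e2 ler_pM2l.
have : 1 <= (1 + u + 2 * u ^+ 2) * (1 - u).
  have : 0 <= u ^+ 2 * (1 - 2 * u) by apply: mulr_ge0; [exact: sqr_ge0|lra].
  lra.
move=> h1 h2; rewrite -(@ler_pM2r _ (1 - u)) ?(le_trans h2)//; lra.
Qed.

Lemma expR_opp_powR_decay (R : realType) (e del p : R) : 0 < e -> 0 < del ->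
  exists2 K : R, 0 < K & forall N : nat, (0 < N)%N ->
    expR (- (e * N%:R `^ del)) <= K * N%:R `^ (- p).
Proof.
move=> e0 del0.
(* From exp x >= x^(n+1) / (n+1)! with x = e N^del one gets decay of order del (n+1); this [n] makes
   that order at least [p]. *)
pose n := Num.truncn (p / del).
have np : p <= del * n.+1%:R.
  by rewrite mulrC -ler_pdivrMr// ltW// truncnS_gt.
exists (n.+1`!%:R / e ^+ n.+1) => [|N N0].
  by rewrite divr_gt0// ?exprn_gt0// ltr0n fact_gt0.
have NR : 1 <= N%:R :> R by rewrite ler1n.
have x0 : 0 < e * N%:R `^ del by rewrite mulr_gt0// powR_gt0// (lt_le_trans _ NR).
rewrite expRN powRN -(invf_div (e ^+ n.+1)) -invfM lef_pV2 ?posrE ?expR_gt0//; last first.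
  by rewrite mulr_gt0 ?divr_gt0 ?exprn_gt0 ?ltr0n ?fact_gt0// powR_gt0 ?ltr0n.
apply: le_trans (expR_ge1Dxn n (ltW x0)).
rewrite exprMn -(powR_mulrn _ (powR_ge0 N%:R del)) -powRrM [leLHS]mulrAC.
rewrite ler_wpDl// ler_pM2r ?invr_gt0 ?ltr0n ?fact_gt0// ler_pM2l ?exprn_gt0//.
exact: ler_powR.
Qed.

(** With l = ln((n+1)/n) >= 1/(n+1), one has n^(-s) = (n+1)^(-s) exp(s l) >= (n+1)^(-s) (1 +
    s/(n+1)). *)
Lemma powR_telescope (R : realType) (s : R) (n : nat) : 0 < s -> (0 < n)%N ->
  s * n.+1%:R `^ (- (1 + s)) <= n%:R `^ (- s) - n.+1%:R `^ (- s).
Proof.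
move=> s0 n0.
have n0R : 0 < n%:R :> R by rewrite ltr0n.
have nS0 : 0 < n.+1%:R :> R by rewrite ltr0n.
pose l := ln (n.+1%:R / n%:R) : R.
have l1 : n.+1%:R^-1 <= l.
  have := expR_ge1Dx (- l).
  rewrite expRN lnK ?posrE ?divr_gt0// invf_div => h.
  have : n%:R / n.+1%:R = 1 - n.+1%:R^-1 :> R.
    by rewrite -[n.+1%:R]natr1; field; rewrite natr1 gt_eqF.
  by move=> E; rewrite E lerD2l lerN2 in h.
have -> : n%:R `^ (- s) = n.+1%:R `^ (- s) * expR (s * l) :> R.
  rewrite /powR !gt_eqF// -expRD /l ln_div ?posrE//; congr expR; ring.
have -> : n.+1%:R `^ (- (1 + s)) = n.+1%:R `^ (- s) * n.+1%:R^-1 :> R.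
  rewrite opprD addrC powRD; last by rewrite (gt_eqF nS0) implybT.
  congr (_ * _).
  by rewrite powR_inv1// ltW.
have := expR_ge1Dx (s * l) => h.
rewrite -[X in _ - X]mulr1 -mulrBr mulrCA ler_wpM2l ?powR_ge0//.
have : s * n.+1%:R^-1 <= s * l by rewrite ler_wpM2l// ltW.
by move=> /le_trans; apply; lra.
Qed.

Lemma nneseries_powR_lty (R : realType) (K s : R) : 0 <= K -> 0 < s ->
  (\sum_(n <oo) (K * n.+1%:R `^ (- (1 + s)))%:E < +oo)%E.
Proof.
move=> K0 s0.
(* The first term is 1 and the others telescope, which bounds every partial sum by K (1 + 1/s). *)
have H n : \sum_(0 <= i < n.+1) (K * i.+1%:R `^ (- (1 + s))) <=
    K * (1 + s^-1 * (1 - n.+1%:R `^ (- s))) :> R.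
  elim: n => [|n IH].
    by rewrite big_nat1 !powR1 subrr mulr0 addr0.
  rewrite big_nat_recr//= (le_trans (lerD IH (lexx _)))//.
  rewrite -mulrDr ler_wpM2l//.
  have := @powR_telescope R s n.+1 s0 isT.
  set x := _ `^ (- (1 + s)); set y := _ - _ => xy.
  have {}xy : x <= s^-1 * y by rewrite mulrC ler_pdivlMr// mulrC.
  by move: xy; rewrite /y mulrBr !mulrBr; lra.
apply: (@le_lt_trans _ _ (K * (1 + s^-1))%:E); last exact: ltry.
apply: lime_le.
  by apply: is_cvg_nneseries => n _ _; rewrite lee_fin mulr_ge0// powR_ge0.
near=> n.
rewrite sumEFin lee_fin.
have -> : n = n.-1.+1 by rewrite prednK//; near: n; exists 1%N.
rewrite (le_trans (H _))// ler_wpM2l// lerD2l ler_piMr ?invr_ge0 ?ltW//.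
Unshelve. all: by end_near. Qed.

(** * Markov and Chernoff inequalities *)

Lemma measurable_ge_fun d (T : measurableType d) (R : realType) (f : T -> R) (c : R) :
  measurable_fun setT f -> measurable [set w | c <= f w].
Proof.
move=> mf; rewrite (_ : [set w | _] = setT `&` f @^-1` `[c, +oo[); first exact: mf.
apply/seteqP; split => w /=; rewrite in_itv/= andbT; first by [].
by case.
Qed.

Lemma markov_subset d (T : measurableType d) (R : realType)
    (P : probability T R) (f : T -> R) (c : R) (A : set T) :
  measurable_fun setT f -> (forall w, 0 <= f w) -> measurable A ->
  0 <= c -> (forall w, A w -> c <= f w) ->
  (c%:E * P A <= \int[P]_w (f w)%:E)%E.
Proof.
move=> mf f0 mA c0 cf; rewrite -integral_cst//.
apply: (@le_trans _ _ (\int[P]_(w in A) (f w)%:E)%E).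
  apply: ge0_le_integral => //=.
  exact/measurable_EFinP/measurable_funTS.
apply: ge0_subset_integral => //; first exact/measurable_EFinP.
by move=> w _; rewrite lee_fin.
Qed.

(** Integrating the quadratic bound gives 1 + s mu + q v at most, and 1 + u <= exp u puts this in
    exponential form, so that a product of such bounds becomes a multiple of one exponent. *)
Lemma expectation_expR_le d (T : measurableType d) (R : realType)
    (P : probability T R) (X : T -> R) (h : R -> R) (s q mu v : R) :
  measurable_fun setT X -> measurable_fun setT h -> (forall w, 0 < X w) ->
  (\int[P]_w (X w)%:E = mu%:E)%E ->
  (\int[P]_w (X w ^+ 2)%:E <= v%:E)%E ->
  0 <= q ->
  (forall x : R, 0 < x -> expR (h x) <= 1 + s * x + q * x ^+ 2) ->
  (\int[P]_w (expR (h (X w)))%:E <= (expR (s * mu + q * v))%:E)%E.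
Proof.
move=> mX mh X0 EX EX2 q0 hle.
have iX : P.-integrable setT (fun w => (X w)%:E).
  apply/integrableP; split; first exact/measurable_EFinP.
  under eq_integral do rewrite gee0_abs ?lee_fin ?ltW//.
  by rewrite EX ltry.
have mX2 : measurable_fun setT (fun w => X w ^+ 2) by exact: measurable_funX.
have iX2 : P.-integrable setT (fun w => (X w ^+ 2)%:E).
  apply/integrableP; split; first exact/measurable_EFinP.
  under eq_integral do rewrite gee0_abs ?lee_fin ?sqr_ge0//.
  by rewrite (le_lt_trans EX2) ?ltry.
have i1 : P.-integrable setT (fun w : T => 1%:E).
  exact: finite_measure_integrable_cst.
have isX : P.-integrable setT (fun w => s%:E * (X w)%:E)%E by exact: integrableZl.
have iqX : P.-integrable setT (fun w => q%:E * (X w ^+ 2)%:E)%E by exact: integrableZl.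
have i1s : P.-integrable setT (fun w => 1%:E + s%:E * (X w)%:E)%E by exact: integrableD.
apply: (@le_trans _ _ (\int[P]_w (1%:E + s%:E * (X w)%:E + q%:E * (X w ^+ 2)%:E))%E).
  apply: ge0_le_integral => //=.
  - by apply/measurable_EFinP; apply: measurableT_comp => //; exact: measurableT_comp.
  - by move: (integrableD measurableT i1s iqX) => /measurable_int.
  - by move=> w _; rewrite lee_fin; exact: hle.
rewrite integralD// integralD// integralZl// integralZl// EX integral_cst//= mul1e.
rewrite [P _]probability_setT.
apply: (@le_trans _ _ (1 + s * mu + q * v)%:E); last first.
  by rewrite lee_fin -addrA expR_ge1Dx.
by rewrite !EFinD !EFinM leeD2l// lee_wpmul2l// lee_fin.
Qed.

(** Markov's inequality for the exponential of the sum, whose expectation is at most a product of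
    [m] factors, each bounded by exp k. *)
Lemma NSD_chernoff d (T : measurableType d) (R : realType)
    (P : probability T R) (X : nat -> T -> R) (m : nat) (h : R -> R) (k c : R) :
  (forall i, measurable_fun setT (X i)) ->
  NSD P (fun i : 'I_m => X i) ->
  measurable_fun setT h ->
  {homo h : x y / x <= y} \/ {homo h : x y /~ x <= y} ->
  (forall i, \int[P]_w (expR (h (X i w)))%:E <= (expR k)%:E)%E ->
  (P [set w | (c <= \sum_(i < m) h (X i w))%R] <= (expR (m%:R * k - c))%:E)%E.
Proof.
move=> mX nsd mh hh Ek.
have mS : measurable_fun setT (fun w => \sum_(i < m) h (X i w)).
  by apply: measurable_sum => i; exact: measurableT_comp.
set A := [set w | _].
have mA : measurable A by exact: measurable_ge_fun.
have : ((expR c)%:E * P A <= (expR (m%:R * k))%:E)%E.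
  apply: (@le_trans _ _ (\int[P]_w (expR (\sum_(i < m) h (X i w)))%:E)%E).
    apply: markov_subset => //.
    - exact: measurableT_comp.
    - by move=> w; rewrite /A /= ler_expR.
  apply: le_trans (NSD_expR_sum mX nsd mh hh) _.
  have {}Ek i : (0 <= \int[P]_w (expR (h (X i w)))%:E)%E /\
      (\int[P]_w (expR (h (X i w)))%:E <= (expR k)%:E)%E.
    by split=> //; apply: integral_ge0 => w _; rewrite lee_fin expR_ge0.
  rewrite expRM_natl -[m in X in (_ <= X)%E]card_ord -prodr_const.
  (* Nonnegativity is carried through the induction because multiplying inequalities between
     extended reals requires it. *)
  have [] : (0 <= \prod_(i < m) \int[P]_w (expR (h (X i w)))%:E)%E /\
     (\prod_(i < m) \int[P]_w (expR (h (X i w)))%:E <=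
       (\prod_(i < m) expR k)%:E)%E; last by [].
  elim/big_ind2 : _ => // x1 y1 x2 y2 [x10 xy1] [x20 xy2]; split.
    exact: mule_ge0.
  by rewrite EFinM; exact: lee_pmul.
by rewrite expRB EFinM lee_pdivlMr ?expR_gt0// muleC.
Qed.

(** * Tail bounds for the partial sums [tau] *)

(** For y = N X >= 0 one has y^2 <= 1 + y^(2+r), by separating y <= 1 from y > 1; integrate and
    divide by N^2. *)
Lemma second_moment_le d (T : measurableType d) (R : realType)
    (P : probability T R) (X : T -> R) (r C : R) (N : nat) :
  measurable_fun setT X -> (forall w, 0 < X w) -> 0 < r -> (0 < N)%N ->
  (\int[P]_w (X w `^ (2 + r))%:E <= (C / N%:R `^ (2 + r))%:E)%E ->
  (\int[P]_w (X w ^+ 2)%:E <= ((1 + C) / N%:R ^+ 2)%:E)%E.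
Proof.
move=> mX X0 r0 N0 EX.
have NR : 0 < N%:R :> R by rewrite ltr0n.
have N2 : 0 < N%:R ^+ 2 :> R by rewrite exprn_gt0.
have N2V : 0 <= (N%:R ^+ 2)^-1 :> R by rewrite invr_ge0 ltW.
pose Y w := X w `^ (2 + r).
have Y0 w : 0 <= Y w by exact: powR_ge0.
have mY : measurable_fun setT Y.
  exact: (measurableT_comp (measurable_powR (2 + r)) mX).
have NE : N%:R `^ (2 + r) = N%:R ^+ 2 * N%:R `^ r :> R.
  by rewrite powRD ?(gt_eqF NR) ?implybT// powR_mulrn// ltW.
apply: (@le_trans _ _ (\int[P]_w ((N%:R ^+ 2)^-1 + N%:R `^ r * Y w)%:E)%E).
  apply: ge0_le_integral => //=.
  - by move=> w _; rewrite lee_fin sqr_ge0.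
  - by apply/measurable_EFinP; exact: measurable_funX.
  - apply/measurable_EFinP; apply: measurable_funD => //.
    exact: measurable_funM.
  move=> w _; rewrite lee_fin -(ler_pM2l N2) mulrDr divff ?gt_eqF//.
  rewrite [X in _ + X]mulrA -NE /Y -powRM ?(ltW NR) ?(ltW (X0 w))// -exprMn.
  have y0 : 0 < N%:R * X w by rewrite mulr_gt0.
  have [y1|y1] := leP (N%:R * X w) 1.
    by apply: le_trans (exprn_ile1 2 (ltW y0) y1) _; rewrite lerDl powR_ge0.
  rewrite (@le_trans _ _ ((N%:R * X w) `^ (2 + r)))// ?lerDr//.
  rewrite -powR_mulrn ?(ltW y0)// ler_powR ?(ltW y1)//.
  by rewrite lerDl ltW.
under eq_integral do rewrite EFinD.
rewrite ge0_integralD//=; last 2 first.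
- by move=> w _; rewrite lee_fin mulr_ge0// powR_ge0.
- by apply/measurable_EFinP; exact: measurable_funM.
rewrite integral_cst//= [P _]probability_setT mule1.
under eq_integral do rewrite EFinM.
rewrite ge0_integralZl_EFin ?powR_ge0//; last 2 first.
- by move=> w _; rewrite lee_fin.
- exact/measurable_EFinP.
rewrite mulrDl mul1r EFinD leeD2l//.
apply: le_trans (lee_wpmul2l _ EX) _; first by rewrite lee_fin powR_ge0.
rewrite -EFinM lee_fin NE.
have a0 : N%:R `^ r != 0 :> R by rewrite gt_eqF// powR_gt0.
set a := _ `^ r in a0 *; rewrite le_eqVlt; apply/orP; left; apply/eqP.
by field; rewrite a0 gt_eqF.
Qed.

(** The function - lam x is negative for x > 0, so the quadratic bound on exp applies without
    truncation. *)
Lemma lower_tail d (T : measurableType d) (R : realType) (P : probability T R)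
    (t : nat -> T -> R) (N : nat) (C lam : R) (m : nat) (c : R) :
  (forall j, measurable_fun setT (t j)) -> (forall j w, 0 < t j w) ->
  0 < lam ->
  (forall j, \int[P]_w (t j w)%:E = (N%:R^-1)%:E)%E ->
  (forall j, \int[P]_w (t j w ^+ 2)%:E <= (C / N%:R ^+ 2)%:E)%E ->
  NSD P (fun i : 'I_m => t i) ->
  (P [set w | (c <= - (lam * tau t m w))%R] <=
   (expR (m%:R * (- lam * N%:R^-1 + 2 * lam ^+ 2 * (C / N%:R ^+ 2)) - c))%:E)%E.
Proof.
move=> mt t0 lam0 Et Et2 nsd; under eq_set do rewrite /tau mulr_sumr -sumrN.
apply: (@NSD_chernoff _ _ _ _ _ _ (fun x => - (lam * x))) => //.
- by apply: measurableT_comp => //; exact: mulrl_measurable.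
- by right => x y xy; rewrite lerN2 ler_pM2l.
move=> i; apply: (@expectation_expR_le _ _ _ _ (t i) (fun x => - (lam * x))) => //.
- by apply: measurableT_comp => //; exact: mulrl_measurable.
- by rewrite mulr_ge0// sqr_ge0.
move=> x x0; have := @expR_le_quadratic R (- (lam * x)).
rewrite sqrrN exprMn mulNr mulrA; apply.
rewrite (@le_trans _ _ 0)// oppr_le0 ltW// mulr_gt0//.
Qed.

(** Truncating at 1/(2 lam) keeps the exponent at most 1/2, as the quadratic bound on exp demands.
    The bound is then increasing in the truncated value, which may be replaced by x itself. *)
Lemma upper_tail d (T : measurableType d) (R : realType) (P : probability T R)
    (t : nat -> T -> R) (N : nat) (C lam : R) (m : nat) (c : R) :
  (forall j, measurable_fun setT (t j)) -> (forall j w, 0 < t j w) ->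
  0 < lam ->
  (forall j, \int[P]_w (t j w)%:E = (N%:R^-1)%:E)%E ->
  (forall j, \int[P]_w (t j w ^+ 2)%:E <= (C / N%:R ^+ 2)%:E)%E ->
  NSD P (fun i : 'I_m => t i) ->
  (P [set w | (c <= lam * \sum_(j < m) Num.min (t j w) (2 * lam)^-1)%R] <=
   (expR (m%:R * (lam * N%:R^-1 + 2 * lam ^+ 2 * (C / N%:R ^+ 2)) - c))%:E)%E.
Proof.
move=> mt t0 lam0 Et Et2 nsd; under eq_set do rewrite mulr_sumr.
have mh : measurable_fun setT (fun x : R => lam * Num.min x (2 * lam)^-1).
  apply: (measurableT_comp (mulrl_measurable lam)).
  by apply: measurable_minr.
apply: (@NSD_chernoff _ _ _ _ _ _ (fun x => lam * Num.min x (2 * lam)^-1)) => //.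
- left => x y xy; rewrite ler_pM2l// le_min !ge_min lexx xy orbT//.
move=> i; apply: (@expectation_expR_le _ _ _ _ (t i)
  (fun x => lam * Num.min x (2 * lam)^-1)) => //.
- by rewrite mulr_ge0// sqr_ge0.
move=> x x0; set y := Num.min _ _.
have yx : y <= x by rewrite /y ge_min lexx.
have y0 : 0 < y by rewrite /y lt_min x0 invr_gt0 mulr_gt0.
have yl : lam * y <= 2^-1.
  rewrite (@le_trans _ _ (lam * (2 * lam)^-1))//; last first.
    by rewrite invfM mulrCA divff ?mulr1// gt_eqF.
  by rewrite ler_pM2l// /y ge_min lexx orbT.
apply: le_trans (expR_le_quadratic yl) _; rewrite exprMn mulrA lerD ?lerD2l ?ler_pM2l//.
  by rewrite ler_pXn2r// nnegrE ltW.
by rewrite mulr_gt0// exprn_gt0.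
Qed.

(** The constant [K] is chosen before the probability space and [N], so that the bounds for
    different [N] form a convergent series. *)
Lemma tau_deviation_event (R : realType) (r C e : R) : 0 < r -> 0 < C -> 0 < e ->
  exists2 K : R, 0 <= K & forall d (T : measurableType d) (P : probability T R)
    (t : nat -> T -> R) (N : nat),
  (forall j, measurable_fun setT (t j)) -> (forall j w, 0 < t j w) ->
  (0 < N)%N ->
  (forall j, \int[P]_w (t j w)%:E = (N%:R^-1)%:E)%E ->
  (forall j, \int[P]_w (t j w `^ (2 + r))%:E <= (C / N%:R `^ (2 + r))%:E)%E ->
  (forall m, NSD P (fun i : 'I_m => t i)) ->
  exists A : set T, [/\ measurable A,
    (P A <= (K * N%:R `^ (- (1 + r / 2)))%:E)%E &
    forall w, ~ A w -> forall i, (i <= N)%N -> `|tau t i w - i%:R / N%:R| < e].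
Proof.
move=> r0 C0 e0.
pose p := 2 + r; pose q := 1 + r / 2.
have p0 : 0 < p by rewrite addr_gt0.
(* With lam = N^del, lam^p = N^(r/2), so (2 lam)^p C / N^p is of order N^(-(2 + r/2)) = N^(-(1 +
   q)): summing over N steps leaves N^(-q). *)
pose del := r / (2 * p).
have del0 : 0 < del by rewrite divr_gt0// mulr_gt0.
have [K0 K00 expK] := @expR_opp_powR_decay R e del (1 + q) e0 del0.
pose D := expR (2 * (1 + C)).
have D0 : 0 < D by exact: expR_gt0.
(* Two deviation events for each of the N + 1 <= 2 N indices give the 4; the second term comes from
   the N truncation events. *)
exists (4 * D * K0 + C * 2 `^ p).
  by rewrite addr_ge0// ?mulr_ge0 ?powR_ge0 ?ltW.
move=> d T P t N mt t0 N0 Et Etp nsd.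
have NR : 0 < N%:R :> R by rewrite ltr0n.
have N1 : 1 <= N%:R :> R by rewrite ler1n.
pose lam : R := N%:R `^ del.
have lam0 : 0 < lam by exact: powR_gt0.
have lam2 : lam ^+ 2 <= N%:R.
  rewrite -powR_mulrn ?(ltW lam0)// -powRrM -[leRHS]powRr1 ?(ltW NR)//.
  apply: ler_powR => //.
  rewrite /del (_ : _ * 2 = r / p); last by field; rewrite gt_eqF.
  by rewrite ler_pdivrMr// mul1r /p lerDr.
have Et2 j : (\int[P]_w (t j w ^+ 2)%:E <= ((1 + C) / N%:R ^+ 2)%:E)%E.
  exact: (@second_moment_le _ _ _ _ (t j) r).
(* Since lam^2 i <= N^2, the second-order part of the Chernoff exponent stays below 2 (1 + C), and
   only - e lam remains to produce decay. *)
have expo (i : nat) : (i <= N)%N ->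
    i%:R * (2 * lam ^+ 2 * ((1 + C) / N%:R ^+ 2)) - lam * e <=
    2 * (1 + C) - e * lam.
  move=> iN; rewrite [lam * e]mulrC lerD2r.
  have iNR : i%:R <= N%:R :> R by rewrite ler_nat.
  have : lam ^+ 2 * i%:R <= N%:R ^+ 2.
    by rewrite [leRHS]expr2 ler_pM// sqr_ge0.
  rewrite (_ : i%:R * _ = (lam ^+ 2 * i%:R / N%:R ^+ 2) * (2 * (1 + C)));
    last by field; rewrite gt_eqF.
  move=> h; rewrite ler_piMl//; first by rewrite mulr_ge0// addr_ge0// ltW.
  by rewrite ler_pdivrMr ?exprn_gt0// mul1r.
pose b : R := (2 * lam)^-1.
have b0 : 0 < b by rewrite invr_gt0 mulr_gt0.
(* [Lo i] says tau_i <= i/N - e, [Up i] that the truncated sum is at least i/N + e, and [Tr j] that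
   truncation affects step [j]. *)
pose Lo (i : nat) := [set w | - lam * (i%:R / N%:R) + lam * e <= - (lam * tau t i w)].
pose Up (i : nat) := [set w | lam * (i%:R / N%:R) + lam * e <=
                       lam * \sum_(j < i) Num.min (t j w) b].
pose Tr (j : nat) := [set w | b <= t j w].
have mtau i : measurable_fun setT (tau t i) by apply: measurable_sum.
have mLo i : measurable (Lo i).
  apply: measurable_ge_fun; apply: measurableT_comp => //.
  exact: (measurableT_comp (mulrl_measurable lam)).
have mUp i : measurable (Up i).
  apply: measurable_ge_fun; apply: (measurableT_comp (mulrl_measurable lam)).
  by apply: measurable_sum => j; exact: measurable_minr.
have mTr j : measurable (Tr j) by exact: measurable_ge_fun.
have expN (i : nat) : (i <= N)%N ->
    (P (Lo i) <= (D * K0 * N%:R `^ (- (1 + q)))%:E)%E /\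
    (P (Up i) <= (D * K0 * N%:R `^ (- (1 + q)))%:E)%E.
  move=> iN.
  have h : expR (2 * (1 + C) - e * lam) <= D * K0 * N%:R `^ (- (1 + q)).
    by rewrite expRB -expRN -mulrA ler_pM2l// expK.
  split.
    apply: (le_trans (lower_tail _ mt t0 lam0 Et Et2 (nsd i))).
    rewrite lee_fin (le_trans _ h)// ler_expR (le_trans _ (expo i iN))//.
    rewrite le_eqVlt; apply/orP; left; apply/eqP; field; rewrite ?gt_eqF//.
  apply: (le_trans (upper_tail _ mt t0 lam0 Et Et2 (nsd i))).
  rewrite lee_fin (le_trans _ h)// ler_expR (le_trans _ (expo i iN))//.
  rewrite le_eqVlt; apply/orP; left; apply/eqP; field; rewrite ?gt_eqF//.
have TrN j : (P (Tr j) <= (C * 2 `^ p * N%:R `^ (- (1 + q)))%:E)%E.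
  have bp : 0 < b `^ p by exact: powR_gt0.
  have : ((b `^ p)%:E * P (Tr j) <= (C / N%:R `^ p)%:E)%E.
    apply: le_trans _ (Etp j); apply: markov_subset => //.
    - exact: (measurableT_comp (measurable_powR p) (mt j)).
    - by move=> w; exact: powR_ge0.
    - exact: ltW.
    - move=> w; rewrite /Tr /= => bt; apply: ge0_ler_powR => //.
      + exact: ltW.
      + by rewrite nnegrE ltW.
      + by rewrite nnegrE ltW.
  rewrite -lee_pdivlMl// => /le_trans; apply.
  have -> : N%:R `^ (- (1 + q)) = lam `^ p / N%:R `^ p :> R.
    rewrite -powRN -powRrM -powRD; last by rewrite (gt_eqF NR) implybT.
    by congr (_ `^ _); rewrite /del /q /p; field; rewrite gt_eqF.
  have -> : (b `^ p)^-1 = 2 `^ p * lam `^ p.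
    by rewrite -powRM ?(ltW lam0)// -powRN -[b]powR_inv1 ?mulr_ge0 ?(ltW lam0)//
      -powRrM mulN1r opprK.
  rewrite -EFinM lee_fin le_eqVlt; apply/orP; left; apply/eqP; ring.
exists ((\big[setU/set0]_(i < N.+1) (Lo i `|` Up i)) `|` (\big[setU/set0]_(j < N) Tr j)).
have m1 : measurable (\big[setU/set0]_(i < N.+1) (Lo i `|` Up i)).
  by apply: bigsetU_measurable => i _; exact: measurableU.
have m2 : measurable (\big[setU/set0]_(j < N) Tr j).
  by apply: bigsetU_measurable.
split.
- exact: measurableU.
- apply: (le_trans (measureU2 P m1 m2)).
  have NN : N%:R `^ (- q) = N%:R * N%:R `^ (- (1 + q)) :> R.
    rewrite -[X in X * _]powRr1 ?(ltW NR)// -powRD; last by rewrite (gt_eqF NR) implybT.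
    by congr (_ `^ _); ring.
  rewrite mulrDl EFinD; apply: leeD.
    have mLU i : measurable (Lo i `|` Up i) by exact: measurableU.
    apply: (le_trans (@Boole_inequality _ _ _ P (fun i => Lo i `|` Up i) N.+1
      (fun i _ => mLU i))).
    apply: (@le_trans _ _ (\sum_(i < N.+1) (2 * D * K0 * N%:R `^ (- (1 + q)))%:E)%E).
      apply: lee_sum => i _; apply: (le_trans (measureU2 P (mLo _) (mUp _))).
      have [h1 h2] := expN i (ltn_ord i).
      apply: le_trans (leeD h1 h2) _; rewrite -EFinD lee_fin le_eqVlt.
      by apply/orP; left; apply/eqP; ring.
    rewrite sumEFin lee_fin sumr_const card_ord NN.
    set x := _ `^ _.
    have x0 : 0 <= x by exact: powR_ge0.
    rewrite -mulr_natr -natr1.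
    have : 0 <= D * K0 * x by rewrite !mulr_ge0// ltW.
    nra.
  apply: (le_trans (@Boole_inequality _ _ _ P Tr N (fun j _ => mTr j))).
  apply: (@le_trans _ _ (\sum_(i < N) (C * 2 `^ p * N%:R `^ (- (1 + q)))%:E)%E).
    by apply: lee_sum => j _; exact: TrN.
  rewrite sumEFin lee_fin sumr_const card_ord NN -mulr_natr.
  by rewrite le_eqVlt; apply/orP; left; apply/eqP; ring.
move=> w nA i iN.
have nLo : ~ Lo i w.
  move=> h; apply: nA; left; rewrite -(bigcup_mkord N.+1 (fun i => Lo i `|` Up i));
    exists i => //; by left.
have nUp : ~ Up i w.
  move=> h; apply: nA; left; rewrite -(bigcup_mkord N.+1 (fun i => Lo i `|` Up i));
    exists i => //; by right.
have nTr j : (j < N)%N -> t j w < b.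
  move=> jN; rewrite ltNge; apply/negP => h; apply: nA; right.
  by rewrite -(bigcup_mkord N Tr); exists j.
(* Off the events [Tr j] truncation changes nothing, so the failure of [Up i] bounds [tau]
   itself. *)
have sE : \sum_(j < i) Num.min (t j w) b = tau t i w.
  apply: eq_bigr => j _; apply/min_idPl; apply/ltW/nTr.
  exact: leq_trans (ltn_ord j) iN.
move: nLo nUp; rewrite /Lo /Up /= sE => /negP; rewrite -ltNge => h1.
move=> /negP; rewrite -ltNge => h2.
rewrite ltr_norml; apply/andP; split; rewrite -(ltr_pM2l lam0); lra.
Qed.

(** * Almost sure uniform closeness of the observation times to the grid *)

(** Besides positivity, this is all that the pathwise limit uses about the observation times. *)
Definition uniformly_close_to_grid (R : realType) (x : nat -> nat -> R) :=
  forall e : R, 0 < e -> \forall N \near \oo, forall i, (i <= N)%N ->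
    `|x N i - i%:R / N%:R| < e.

Lemma tau_uniform_ae d (T : measurableType d) (R : realType)
    (P : probability T R) (t : nat -> nat -> T -> R) (r C : R) :
  (forall N j, measurable_fun setT (t N j)) ->
  (forall N j w, 0 < t N j w) ->
  (forall N j, (0 < N)%N -> ('E_P[t N j] = (N%:R^-1)%:E)%E) ->
  0 < r -> 0 < C ->
  (forall N j, (0 < N)%N ->
     ('E_P[fun w => (t N j w `^ (2 + r))%R] <= (C / N%:R `^ (2 + r))%R%:E)%E) ->
  (forall N m, (0 < N)%N -> NSD P (fun i : 'I_m => t N i)) ->
  {ae P, forall w, uniformly_close_to_grid (fun N i => tau (t N) i w)}.
Proof.
move=> mt t0; rewrite unlock => Et r0 C0 Etp nsd.
(* Countably many thresholds 1/(k+1) suffice, so that the exceptional null sets can be united. *)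
suff H (k : nat) : {ae P, forall w, \forall N \near \oo, forall i, (i <= N)%N ->
      `|tau (t N) i w - i%:R / N%:R| < k.+1%:R^-1}.
  apply: filterS (ae_foralln H) => w Hw e e0.
  near \oo => k; apply: filterS (Hw k) => N HN i iN.
  apply: lt_trans (HN i iN) _.
  by near: k; exact: near_infty_natSinv_lt (PosNum e0).
have ek : 0 < k.+1%:R^-1 :> R by rewrite invr_gt0.
have [K K0 HK] := tau_deviation_event r0 C0 ek.
(* The event [A n] belongs to N = n + 1, because the moment bounds concern positive N. By
   Borel-Cantelli almost every path lies in only finitely many of them. *)
have /choice[A HA] n := HK d T P (t n.+1) n.+1 (mt _) (t0 _) isT
  (fun j => Et n.+1 j isT) (fun j => Etp n.+1 j isT) (fun m => nsd n.+1 m isT).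
have mA n : measurable (A n) by have [] := HA n.
have A0 : P (lim_sup_set A) = 0%E.
  apply: lim_sup_set_cvg0 => //.
  apply: le_lt_trans (@nneseries_powR_lty R K (r / 2) K0 _); last by rewrite divr_gt0.
  by apply: lee_nneseries => n _ //; have [] := HA n.
exists (lim_sup_set A); split => //.
  apply: bigcap_measurable => // n _; exact: bigcup_measurable.
move=> w /= nw n _; apply: contrapT => nex; apply: nw.
exists n.+1 => // N /= nN i iN.
have N0 : (0 < N)%N by exact: leq_ltn_trans nN.
have [_ _] := HA N.-1; rewrite prednK// => /(_ w); apply => // AN.
by apply: nex; exists N.-1 => //=; rewrite -ltnS prednK.
Unshelve. all: by end_near. Qed.

(** * Continuous paths: extension, uniform continuity and primitives *)

(** It extends a path constantly to negative times, so that the calculus below can assume continuity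
    on the whole line. *)
Lemma within_itvcy_continuous_max (R : realType) (f : R -> R) :
  {within `[0, +oo[, continuous f} -> continuous (fun s : R => f (Num.max s 0)).
Proof.
move=> cf x.
have y0 : `[0, +oo[%classic (Num.max x 0) by rewrite /= in_itv/= andbT le_max lexx orbT.
have := (subspace_continuousP _ f).1 cf _ y0 => cy.
apply: cvg_trans cy => U /= fU.
have cm : continuous (fun s : R => Num.max s 0).
  move=> z; apply: (@continuous_max R R id (cst 0)); first exact: cvg_id.
  exact: cvg_cst.
have H : nbhs (Num.max x 0) (fun y => `[0, +oo[%classic y -> U (f y)) by exact: fU.
change (nbhs x (fun z : R => U (f (Num.max z 0)))).
have Hx : nbhs x (fun z : R => `[0, +oo[%classic (Num.max z 0) -> U (f (Num.max z 0))).
  exact: cm x _ H.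
apply: filterS Hx => z; apply.
by rewrite /= in_itv/= andbT le_max lexx orbT.
Qed.

Lemma segment_uniform_continuity (R : realType) (g : R -> R) (a b e : R) :
  continuous g -> 0 < e ->
  exists2 del : R, 0 < del & forall x y, x \in `[a, b] -> `|x - y| < del ->
    `|g x - g y| < e.
Proof.
move=> cg e0.
have /compact_near_coveringP H := @segment_compact R a b.
have : \forall del \near 0^'+, `[a, b]%classic `<=`
    (fun x => forall y, `|x - y| < del -> `|g x - g y| < e).
  apply: H => x _.
  have /cvgrPdist_lt /(_ (e / 2)) := cg x.
  rewrite divr_gt0// => /(_ isT) /nbhs_ballP[eta /= eta0 Heta].
  (* Halving [eta] twice keeps both z and any y within s of z inside the ball of radius [eta] around
     x. *)
  exists (ball x (eta / 2), [set s | 0 < s < eta / 2]) => /=.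
    split; first by apply: nbhsx_ballx; rewrite divr_gt0.
    near=> s; apply/andP; split; near: s; first exact: nbhs_right_gt.
    by apply: nbhs_right_lt; rewrite divr_gt0.
  move=> [z s]/= [xz /andP[s0 s1]] y zy.
  have h1 : `|g x - g z| < e / 2.
    by apply: Heta; apply: lt_trans xz _; rewrite ltr_pdivrMr// ltr_pMr// ltr1n.
  have h2 : `|g x - g y| < e / 2.
    apply: Heta; rewrite /ball/= -(subrKA z) (splitr eta).
    by apply: le_lt_trans (ler_normD _ _) _; apply: ltrD => //; exact: lt_trans s1.
  rewrite -(subrKA (g x)) (splitr e) (le_lt_trans (ler_normD _ _))//.
  by rewrite ltrD// distrC.
move=> [del /= del0 Hdel].
exists (del / 2); first by rewrite divr_gt0.
move=> x y xab xy; apply: (Hdel (del / 2)) => //=.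
  by rewrite sub0r normrN gtr0_norm ?divr_gt0// ltr_pdivrMr// ltr_pMr// ltr1n.
by rewrite divr_gt0.
Unshelve. all: by end_near. Qed.

Lemma continuous_primitive (R : realType) (g : R -> R) : continuous g ->
  exists F : R -> R, (forall x : R, 0 <= x -> is_derive x 1 F (g x)) /\
    \int[lebesgue_measure]_(s in `[0, 1]) g s = F 1 - F 0.
Proof.
move=> cg.
(* Starting at -1 rather than 0 makes 0 an interior point, so [F] has a two-sided derivative
   there. *)
pose F x := \int[lebesgue_measure]_(s in `[-1, x]) g s.
have ig a b : lebesgue_measure.-integrable `[a, b] (EFin \o g).
  apply: continuous_compact_integrable; first exact: segment_compact.
  exact: continuous_subspaceT.
have dF (x : R) : -1 < x -> is_derive x 1 F (g x).
  move=> x1; have xx : x < x + 1 by rewrite ltrDl.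
  have [||dFx <-] := @continuous_FTC1 R g (BLeft (-1)) x (x + 1) xx (ig _ _).
  - by rewrite /= lte_fin.
  - exact: cg.
  by rewrite derive1E; exact: derivableP.
exists F; split=> [x x0|]; first by apply: dF; rewrite (lt_le_trans _ x0)// ltrN10.
have cF (x : R) : -1 < x -> {for x, continuous F}.
  move=> x1; apply: differentiable_continuous; apply/derivable1_diffP.
  by have [] := dF x x1.
rewrite /Rintegral (@continuous_FTC2 R g F 0 1)//.
- exact: continuous_subspaceT.
- split => [x||].
  + rewrite in_itv/= => /andP[x0 _]; have [] // := dF x _.
    by rewrite (lt_trans _ x0)// ltrN10.
  + by apply: cvg_at_right_filter; apply: cF; rewrite ltrN10.
  + by apply: cvg_at_left_filter; apply: cF; rewrite (lt_trans _ ltr01)// ltrN10.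
- move=> x; rewrite in_itv/= => /andP[x0 _].
  by rewrite derive1E; apply: derive_val; apply: dF; rewrite (lt_trans _ x0)// ltrN10.
Qed.

(** * Riemann sums and mean squares along nearly uniform points *)

Lemma close_to_grid_last_cvg (R : realType) (x : nat -> nat -> R) :
  uniformly_close_to_grid x -> (fun N => x N N) @ \oo --> (1 : R).
Proof.
move=> Hx; apply/cvgrPdist_lt => e e0.
near=> N.
have N0 : (0 < N)%N by near: N; exists 1%N.
have close : forall i, (i <= N)%N -> `|x N i - i%:R / N%:R| < e.
  by near: N; exact: Hx.
by have := close N (leqnn N); rewrite divff ?pnatr_eq0 -?lt0n// distrC.
Unshelve. all: by end_near. Qed.

(** The increments of a primitive [F] telescope to F(x_N) - F(0), which tends to the integral. By
    the mean value theorem each increment is g(c) times the step, and uniform continuity compares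
    g(c) with the value at the left endpoint. *)
Lemma riemann_sum_cvg (R : realType) (g : R -> R) (x : nat -> nat -> R) :
  continuous g -> (forall N, x N 0%N = 0) ->
  (forall N i, x N i <= x N i.+1) -> uniformly_close_to_grid x ->
  (fun N => \sum_(i < N) g (x N i) * (x N i.+1 - x N i)) @ \oo -->
  \int[lebesgue_measure]_(s in `[0, 1]) g s.
Proof.
move=> cg x0 xS Hx.
have [F [dF ->]] := continuous_primitive cg.
have cF (y : R) : 0 <= y -> {for y, continuous F}.
  move=> y0; apply: differentiable_continuous; apply/derivable1_diffP.
  by have [] := dF y y0.
have x_ge0 N i : 0 <= x N i.
  by elim: i => [|i IH]; [rewrite x0|exact: le_trans (xS N i)].
have cFx : (fun N => F (x N N) - F 0) @ \oo --> F 1 - F 0.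
  apply: cvgB; last exact: cvg_cst.
  exact: (cvg_comp _ _ (close_to_grid_last_cvg Hx) (cF 1 ler01)).
rewrite -[X in _ --> X]addr0.
rewrite (_ : (fun N => _) = (fun N => (F (x N N) - F 0) +
   ((\sum_(i < N) g (x N i) * (x N i.+1 - x N i)) - (F (x N N) - F 0)))); last first.
  by apply/funext => N; rewrite addrC subrK.
apply: cvgD => //.
apply/cvgr0Pnorm_lt => e e0.
have e2 : 0 < e / 3 by rewrite divr_gt0.
(* All points eventually lie in [0, 2], so the total error is at most 2 e / 3 < e. *)
have [del del0 Hdel] := @segment_uniform_continuity R g 0 2 (e / 3) cg e2.
have eta0 : 0 < Num.min (del / 3) 1 by rewrite lt_min divr_gt0//=.
near=> N.
have N0 : (0 < N)%N by near: N; exists 1%N.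
have NR : 0 < N%:R :> R by rewrite ltr0n.
have close : forall i, (i <= N)%N -> `|x N i - i%:R / N%:R| < Num.min (del / 3) 1.
  by near: N; exact: Hx.
have Nd : N%:R^-1 < del / 3.
  rewrite invf_plt ?posrE ?divr_gt0//; near: N; exact: nbhs_infty_gtr.
have mono i : (i <= N)%N -> x N i <= x N N.
  by have /nondecreasing_seqP := xS N; exact.
have xN2 : x N N <= 2.
  have := close N (leqnn N); rewrite divff ?gt_eqF// lt_min => /andP[_].
  by rewrite ltr_norml => /andP[_]; lra.
have FE : F (x N N) - F 0 = \sum_(i < N) (F (x N i.+1) - F (x N i)).
  rewrite -(big_mkord xpredT (fun i => F (x N i.+1) - F (x N i))).
  by rewrite telescope_sumr// x0.
rewrite FE -sumrB.
apply: (@le_lt_trans _ _ (\sum_(i < N) e / 3 * (x N i.+1 - x N i))); last first.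
  rewrite -mulr_sumr -(big_mkord xpredT (fun i => x N i.+1 - x N i)) telescope_sumr//.
  rewrite x0 subr0; nra.
apply: le_trans (ler_norm_sum _ _ _) _; apply: ler_sum => i _.
(* Two grid errors and the grid step 1/N, each below del / 3. *)
have step : x N i.+1 - x N i < del.
  have := close i (ltnW (ltn_ord i)); have := close i.+1 (ltn_ord i).
  rewrite !lt_min => /andP[+ _] /andP[+ _].
  rewrite !ltr_norml => /andP[_ h1] /andP[h2 _].
  move: h1; rewrite -natr1 mulrDl mul1r => h1.
  move: Nd h1 h2; set u := i%:R / N%:R; set v := N%:R^-1; lra.
have [||c] := @MVT_segment R F g (x N i) (x N i.+1) (xS N i).
- move=> y; rewrite in_itv/= => /andP[y0 _]; apply: dF.
  by rewrite (le_trans _ (ltW y0)).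
- apply: continuous_in_subspaceT => y; rewrite inE/= in_itv/= => /andP[y0 _].
  by apply: cF; rewrite (le_trans _ y0).
rewrite in_itv/= => /andP[c1 c2] ->.
rewrite -mulrBl normrM [X in _ * X]ger0_norm ?subr_ge0// ler_wpM2r ?subr_ge0//.
apply/ltW/Hdel.
  by rewrite in_itv/= x_ge0 (le_trans (mono i (ltnW (ltn_ord i)))).
by rewrite distrC ger0_norm ?subr_ge0// (le_lt_trans _ step)// lerD2r.
Unshelve. all: by end_near. Qed.

Lemma mean_square_cvg (R : realType) (x : nat -> nat -> R) :
  uniformly_close_to_grid x ->
  (fun N => N%:R^-1 * \sum_(1 <= i < N.+1) x N i ^+ 2) @ \oo --> (3^-1 : R).
Proof.
move=> Hx; apply/cvgrPdist_lt => e e0.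
have sq N : \sum_(1 <= i < N.+1) (i%:R ^+ 2) =
    N%:R * (N%:R + 1) * (2 * N%:R + 1) / 6 :> R.
  elim: N => [|N IH]; first by rewrite big_nil !mul0r.
  by rewrite big_nat_recr//= IH -[N.+1%:R]natr1; field.
(* In z^2 - y^2 = (z - y)(z + y) the second factor is at most 3, as y <= 1 and |z - y| <= 1, so each
   term is at most e / 2. *)
pose eta := Num.min (e / 6) 1.
have eta0 : 0 < eta by rewrite lt_min divr_gt0//=.
near=> N.
have N0 : (0 < N)%N by near: N; exists 1%N.
have NR : 1 <= N%:R :> R by rewrite ler1n.
have close : forall i, (i <= N)%N -> `|x N i - i%:R / N%:R| < eta.
  by near: N; exact: Hx.
have Nd : N%:R^-1 < e / 2.
  rewrite invf_plt ?posrE ?divr_gt0 ?ltr0n//; near: N; exact: nbhs_infty_gtr.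
(* The mean of the squares (i/N)^2 is 1/3 + (3N + 1)/(6N^2), and this excess is at most 1/N. *)
have E : 3^-1 - N%:R^-1 * \sum_(1 <= i < N.+1) x N i ^+ 2 =
  - (N%:R^-1 * \sum_(1 <= i < N.+1) (x N i ^+ 2 - (i%:R / N%:R) ^+ 2))
  - (3 * N%:R + 1) / (6 * N%:R ^+ 2).
  have sqN : \sum_(1 <= i < N.+1) (i%:R / N%:R) ^+ 2 =
      N%:R * (N%:R + 1) * (2 * N%:R + 1) / 6 / N%:R ^+ 2 :> R.
    by under eq_bigr do rewrite expr_div_n; rewrite -mulr_suml sq.
  rewrite sumrB sqN; field; rewrite gt_eqF//; lra.
rewrite E (splitr e) (le_lt_trans (ler_normD _ _))// !normrN ler_ltD//.
  rewrite normrM ger0_norm ?invr_ge0 ?ler0n// mulrC ler_pdivrMr; last lra.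
  rewrite big_add1 big_mkord (le_trans (ler_norm_sum _ _ _))//.
  rewrite mulr_natr -[N in leRHS]card_ord -sumr_const; apply: ler_sum => i _.
  have := close i.+1 (ltn_ord i).
  have y1 : 0 <= (i.+1%:R / N%:R : R) <= 1.
    rewrite divr_ge0//= ler_pdivrMr ?mul1r ?ler_nat//; lra.
  move: y1; set y := i.+1%:R / N%:R; set z := x N i.+1 => /andP[y0 y1].
  have [ee e1] : eta <= e / 6 /\ eta <= 1 by rewrite /eta !ge_min !lexx orbT.
  rewrite subr_sqr normrM !ltr_norml => /andP[h1 h2].
  have zy : `|z + y| <= 3 by rewrite ler_norml; apply/andP; split; lra.
  have zy' : `|z - y| <= e / 6 by rewrite ler_norml; apply/andP; split; lra.
  rewrite (le_trans (ler_pM _ _ zy' zy))//; lra.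
rewrite ger0_norm; last by rewrite divr_ge0// ?mulr_ge0 ?exprn_ge0//; lra.
apply: le_lt_trans Nd; rewrite ler_pdivrMr; last by rewrite mulr_gt0// exprn_gt0//; lra.
rewrite mulrCA expr2 mulKf; last by rewrite gt_eqF//; lra.
by lra.
Unshelve. all: by end_near. Qed.

(** * The estimation error on a single path, and the conclusion *)

(** Differences move from [f], which need not have bounded variation, to the monotone times, giving
    a Riemann sum. *)
Lemma abel_summation (R : realType) (f : R -> R) (x : nat -> R) (N : nat) : x 0%N = 0 ->
  \sum_(1 <= i < N.+1) (f (x i) - f (x i.-1)) * x i =
  f (x N) * x N - \sum_(i < N) f (x i) * (x i.+1 - x i).
Proof.
move=> x0; elim: N => [|N IH]; first by rewrite big_nil big_ord0 x0 mulr0 subr0.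
by rewrite big_nat_recr//= IH big_ord_recr/=; ring.
Qed.

Lemma ahat_sub (T : Type) (R : realType) (a : R) (W : R -> T -> R)
    (t : nat -> T -> R) (N : nat) (w : T) : (0 < N)%N -> (forall j, 0 < t j w) ->
  ahat a W t N w - a =
  (\sum_(1 <= i < N.+1) (W (tau t i w) w - W (tau t i.-1 w) w) * tau t i w) /
  (\sum_(1 <= i < N.+1) tau t i w ^+ 2).
Proof.
move=> N0 t0; rewrite /ahat.
set Q := \sum_(1 <= i < N.+1) tau t i w ^+ 2.
(* The term i = 1 is the square of the first step, which is positive. *)
have Q0 : Q != 0.
  rewrite gt_eqF// /Q big_ltn// ltr_wpDr//.
    by apply: sumr_ge0 => i _; exact: sqr_ge0.
  by rewrite exprn_gt0// /tau big_ord1.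
rewrite -[X in _ - X](mulfK Q0) -mulrBl; congr (_ / _).
rewrite /Q mulr_sumr -sumrB; apply: eq_bigr => i _; rewrite /Yobs; ring.
Qed.

Lemma ahat_cvg_pathwise (T : Type) (R : realType) (a : R) (W : R -> T -> R)
    (t : nat -> nat -> T -> R) (w : T) :
  (forall N j, 0 < t N j w) ->
  {within `[0, +oo[, continuous (fun s => W s w)} ->
  uniformly_close_to_grid (fun N i => tau (t N) i w) ->
  (fun N : nat => N%:R * (ahat a W (t N) N w - a)) @ \oo -->
    3 * (\int[lebesgue_measure]_(s in `[0, 1]) (W 1 w - W s w)).
Proof.
move=> t0 cW close.
pose g (s : R) := W (Num.max s 0) w.
have cg : continuous g := within_itvcy_continuous_max cW.
have gE (s : R) : 0 <= s -> g s = W s w by move=> s0; rewrite /g max_l.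
pose x N i := tau (t N) i w.
have x0 N : x N 0%N = 0 by rewrite /x /tau big_ord0.
have xS N i : x N i <= x N i.+1 by rewrite /x /tau big_ord_recr/= lerDl ltW.
have x_ge0 N i : 0 <= x N i by apply: sumr_ge0 => j _; exact: ltW.
have ig : lebesgue_measure.-integrable `[0, 1] (EFin \o g).
  apply: continuous_compact_integrable; first exact: segment_compact.
  exact: continuous_subspaceT.
have ic : lebesgue_measure.-integrable `[(0 : R), 1] (EFin \o cst (g 1)).
  apply: continuous_compact_integrable; first exact: segment_compact.
  by apply: continuous_subspaceT => y; exact: cvg_cst.
have -> : \int[lebesgue_measure]_(s in `[0, 1]) (W 1 w - W s w) =
    g 1 * 1 - \int[lebesgue_measure]_(s in `[0, 1]) g s.
  transitivity (\int[lebesgue_measure]_(s in `[0, 1]) (cst (g 1) s - g s)).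
    apply: eq_Rintegral => s; rewrite inE/= in_itv/= => /andP[s0 _].
    by rewrite !gE.
  rewrite RintegralB// Rintegral_cst//.
  by rewrite /= lebesgue_measure_itv/= lte_fin ltr01 oppr0 adde0.
have cS : (fun N => \sum_(1 <= i < N.+1) (g (x N i) - g (x N i.-1)) * x N i) @ \oo -->
    g 1 * 1 - \int[lebesgue_measure]_(s in `[0, 1]) g s.
  under eq_fun do rewrite abel_summation//.
  apply: cvgB; last exact: riemann_sum_cvg.
  have cx := close_to_grid_last_cvg close.
  by apply: cvgM => //; exact: (cvg_comp _ _ cx (cg 1)).
have n3 : (3^-1 : R) != 0 by rewrite invr_eq0.
have cM : (fun N => (N%:R^-1 * \sum_(1 <= i < N.+1) x N i ^+ 2)^-1 *
      \sum_(1 <= i < N.+1) (g (x N i) - g (x N i.-1)) * x N i) @ \oo -->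
    3 * (g 1 * 1 - \int[lebesgue_measure]_(s in `[0, 1]) g s).
  (* The factor 3 is the inverse of the limit 1/3 of the mean squares. *)
  rewrite -[X in X * (g 1 * 1 - _)]invrK.
  by apply: cvgM => //; exact: (cvgV n3 (mean_square_cvg close)).
apply: cvg_trans cM; apply: near_eq_cvg; near=> N.
have N0 : (0 < N)%N by near: N; exists 1%N.
rewrite ahat_sub//= invfM invrK.
rewrite -mulrA; congr (_ * _); rewrite mulrC; congr (_ / _).
by apply: eq_bigr => i _; rewrite !gE.
Unshelve. all: by end_near. Qed.

Unset Implicit Arguments.

Theorem theorem2p2 (d : measure_display) (T : measurableType d) (R : realType)
  (P : probability T R) (t : nat -> nat -> T -> R) (r Ct : R)
  (W : R -> T -> R) (a : R) :
  (forall N j, measurable_fun setT (t N j)) ->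
  (forall N j w, 0 < t N j w) ->
  (forall N j, (0 < N)%N -> ('E_P[t N j] = (N%:R^-1)%:E)%E) ->
  0 < r -> 0 < Ct ->
  (forall N j, (0 < N)%N ->
     ('E_P[fun w => (t N j w `^ (2 + r))%R] <= (Ct / N%:R `^ (2 + r))%R%:E)%E) ->
  (forall N m, (0 < N)%N -> NSD P (fun i : 'I_m => t N i)) ->
  (forall s, measurable_fun setT (W s)) ->
  {ae P, forall w, {within `[0, +oo[, continuous (fun s => W s w)}} ->
  {ae P, forall w,
     (fun N : nat => N%:R * (ahat a W (t N) N w - a)) @ \oo -->
       3 * (\int[lebesgue_measure]_(s in `[0, 1]) (W 1 w - W s w))}.
Proof.
move=> mt t0 Et r0 C0 Etp nsd _ cW.
have close := tau_uniform_ae mt t0 Et r0 C0 Etp nsd.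
apply: filterS2 cW close => w cWw closew.
exact: ahat_cvg_pathwise.
Qed.
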